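(* Let $X$ be a Polish space with metric $d$, and let $\mathcal{Z}^\rho$ ($\rho\in[0,1]$) be the Feller Markov processes on $\mathcal{H}_\rho$ described in the context. Assume that for every compact set $K\subseteq C([-1,0],X)$, all $t\ge s$ and all $\eta>0$, $$\lim_{\rho\to0}\ \sup_{(\psi,j)\in\mathcal{T}_\rho K}P\big(d(Z^\rho(t,s,\psi,j)(0),\,Z^0(t,s,\psi(0),j))\ge\eta\big)=0 .$$ Let $\rho_n\in(0,1]$ for $n\in\mathbb{N}$, and for each $n$ let $\{\mu_t^{\rho_n}\}_{t\in\mathbb{R}}$ be an evolution system of measures of $\mathcal{Z}^{\rho_n}$ in $\mathcal{H}_{\rho_n}$. Suppose that for each $t\in\mathbb{R}$ the sequence $\{\mu_t^{\rho_n}\}_{n=1}^\infty$ is tight in the sense that for every $\epsilon>0$ there exists a compact set $K_1\subseteq C([-1,0],X)$ such that $$\mu_t^{\rho_n}(\mathcal{T}_{\rho_n}K_1)>1-\epsilon\quad\text{for all }n\in\mathbb{N}.$$ Then: (i) For each $t\in\mathbb{R}$, the sequence $\{\mu_t^{\rho_n}\circ T_{\rho_n}^{-1}\}_{n=1}^\infty$ is tight on $\mathcal{H}_0$. (ii) If $\rho_n\to0$ and $\{\mu_t\}_{t\in\mathbb{R}}$ is a family of probability measures on $\mathcal{H}_0$ such that $\mu_t^{\rho_n}\circ T_{\rho_n}^{-1}\to\mu_t$ weakly as $n\to\infty$ for each $t\in\mathbb{R}$, then $\{\mu_t\}_{t\in\mathbb{R}}$ is an evolution system of measures of $\mathcal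{Z}^0$.
   Context: $(\Omega,\mathcal{F},P)$ is a probability space, $S=\{1,\dots,N\}$ is a finite set, and $r_{s,j}(t)$, $t\ge s$, is a right-continuous irreducible Markov chain with state space $S$ (with a fixed generator) starting from $j\in S$ at time $s\in\mathbb{R}$. For $\rho\in(0,1]$, $C([-\rho,0],X)$ carries the supremum metric; $\mathcal{H}_\rho=C([-\rho,0],X)\times S$ and $\mathcal{H}_0=X\times S$, with the product metrics ($S$ carrying $|j_1-j_2|$). For every $\rho\in(0,1]$, $\psi\in C([-\rho,0],X)$, $j\in S$ and $s\in\mathbb{R}$, $\{Z^\rho(t,s,\psi,j),t\ge s\}$ is a stochastic process on $\Omega$ with state space $C([-\rho,0],X)$ and $Z^\rho(s,s,\psi,j)=\psi$, $r(s)=j$. For every $z\in X$, $j\in S$ and $s\in\mathbb{R}$, $\{Z^0(t,s,z,j),t\ge s\}$ is a stochastic process on $\Omega$ with state space $X$ and $Z^0(s,s,z,j)=z$, $r(s)=j$. For $\rho\in[0,1]$ put $\mathcal{Z}^\rho(t,s,\cdot,j)=(Z^\rho(t,s,\cdot,j),r_{s,j}(t))$, an $\mathcal{H}_\rho$-valued process. It is assumed that each $\mathcal{Z}^\rho$, $\rho\in[0,1]$, is a time-nonhomogeneous Markov process whose transition operators $(P^\rho_{s,t}\varphi)(x)=\mathbb{E}[\varphi(\mathcal{Z}^\rho(t,s,x))]$, $x\in\mathcal{H}_\rho$, are Feller, i.e. map bounded continuous functions on $\mathcal{H}_\rho$ to bounded continuous functions on $\mathcal{H}_\rho$. An evolution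 system of measures of $\mathcal{Z}^\rho$ is a family $\{\mu_t\}_{t\in\mathbb{R}}$ of probability measures on $\mathcal{H}_\rho$ with $\int_{\mathcal{H}_\rho}P^\rho_{s,t}\varphi\,d\mu_s=\int_{\mathcal{H}_\rho}\varphi\,d\mu_t$ for all $s<t$ and all bounded continuous $\varphi:\mathcal{H}_\rho\to\mathbb{R}$. For $\rho\in(0,1]$: $T_\rho:\mathcal{H}_\rho\to\mathcal{H}_0$ is $T_\rho(\psi,j)=(\psi(0),j)$, and $\mu\circ T_\rho^{-1}$ is the push-forward; $\mathcal{T}_\rho:\mathcal{H}_1\to\mathcal{H}_\rho$ is the restriction map $\mathcal{T}_\rho(\psi,j)=(\psi|_{[-\rho,0]},j)$. For $D\subseteq C([-1,0],X)$, $\mathcal{T}_\rho D:=\{\mathcal{T}_\rho(\psi,j):\psi\in D,\ j\in S\}\subseteq\mathcal{H}_\rho$. *)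

(* Defs.v *)
From HB Require Import structures.
From mathcomp Require Import all_boot all_order all_algebra.
From mathcomp Require Import all_classical all_reals all_analysis.
From mathcomp Require Import lra.

Set Implicit Arguments.
Unset Strict Implicit.
Unset Printing Implicit Defensive.

Import Order.TTheory GRing.Theory Num.Theory.
Import numFieldNormedType.Exports.

Local Open Scope classical_set_scope.
Local Open Scope ring_scope.

HB.mixin Record isSeparable T & Topological T := {
  separable_subproof : exists2 D : set T, countable D & dense D }.

(* [Complete] contains [Pointed], as does every [measurableType]: a Polish
   space is nonempty here. Completeness is with respect to [mdist]. *)
#[short(type="polishType")]
HB.structure Definition Polish (R : realType) :=
  { T of Metric R T & Complete T & isSeparable T }.

Record delay (R : realType) :=
  Delay { delay_val : R ; delayP : 0 < delay_val <= 1 }.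

Section delay_theory.
Context {R : realType}.
Implicit Type rho : delay R.

Lemma delay_gt0 rho : 0 < delay_val rho.
Proof. by case/andP: (delayP rho). Qed.

Lemma delay_le1 rho : delay_val rho <= 1.
Proof. by case/andP: (delayP rho). Qed.

Fact delay1_subproof : 0 < (1 : R) <= 1. Proof. by rewrite ltr01 lexx. Qed.

Definition delay1 : delay R := Delay delay1_subproof.

(* The filter "rho tends to 0" on (0, 1]. *)
Definition delay_to0 : set_system (delay R) :=
  filter_from [set e : R | 0 < e]
    (fun e => [set rho : delay R | delay_val rho < e]).

Global Instance delay_to0_proper_filter : ProperFilter delay_to0.
Proof.
apply: filter_from_proper; last first.
  move=> e /= e0; have m0 : 0 < Num.min (e / 2) 1 <= 1.
    by rewrite lt_min divr_gt0// ltr01/= ge_min lexx orbT.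
  exists (Delay m0) => /=.
  by rewrite gt_min ltr_pdivrMr// ltr_pMr// ltr1n.
apply: filter_from_filter; first by exists 1 => /=.
move=> e1 e2 /= e10 e20; exists (Num.min e1 e2) => /=.
  by rewrite lt_min e10.
by move=> rho /=; rewrite lt_min => /andP[].
Qed.

Definition dseg rho : set R := `[- delay_val rho, 0].

Fact dseg0_subproof rho : (0 : R) \in dseg rho.
Proof. by rewrite inE /dseg/= in_itv/= lexx oppr_le0 ltW// delay_gt0. Qed.

Definition dseg0 rho : dseg rho := exist _ 0 (dseg0_subproof rho).

Fact dseg_incl_subproof rho (t : dseg rho) : \val t \in dseg delay1.
Proof.
case: t => t /=; rewrite !inE /dseg/= !in_itv/= => /andP[rt ->]; rewrite andbT.
by rewrite (le_trans _ rt)// lerN2 delay_le1.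
Qed.

Definition dseg_incl rho (t : dseg rho) : dseg delay1 :=
  exist _ (\val t) (dseg_incl_subproof t).

Lemma dseg_incl_continuous rho : continuous (@dseg_incl rho).
Proof.
apply/continuous_comp_initial => t.
exact: (@initial_continuous (dseg rho) R set_val).
Qed.

HB.instance Definition _ rho :=
  @isContinuous.Build _ _ (@dseg_incl rho) (@dseg_incl_continuous rho).

End delay_theory.

Arguments delay1 : clear implicits.
Arguments delay_to0 : clear implicits.

(* C([-rho, 0], X) *)
Definition Cseg (R : realType) (X : metricType R) (rho : delay R) :=
  continuousType (dseg rho) X.

Section Cseg_metric.
Context {R : realType} {X : metricType R} {rho : delay R}.
Implicit Types f g h : Cseg X rho.

HB.instance Definition _ := Choice.on (Cseg X rho).

Definition sup_dist f g : R :=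
  sup (range (fun t : dseg rho => mdist (f t) (g t))).

Lemma continuous_mdist f g :
  continuous (fun t : dseg rho => mdist (f t) (g t)).
Proof.
move=> t; apply/(@cvgrPdist_lt _ R^o _ _ (nbhs_filter t)) => e e0.
have e2 : 0 < e / 2 by rewrite divr_gt0.
have cf := @cts_fun _ _ f t; have cg := @cts_fun _ _ g t.
have nf := cf _ (nbhsx_ballx _ _ e2); have ng := cg _ (nbhsx_ballx _ _ e2).
near=> u.
have h1 : mdist (f t) (f u) < e / 2.
  suff : ball (f t) (e / 2) (f u) by rewrite ballEmdist.
  by near: u; exact: nf.
have h2 : mdist (g t) (g u) < e / 2.
  suff : ball (g t) (e / 2) (g u) by rewrite ballEmdist.
  by near: u; exact: ng.
have t1 := metric_triangle (f t) (f u) (g t).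
have t2 := metric_triangle (f u) (g u) (g t).
have t3 := metric_triangle (f u) (f t) (g u).
have t4 := metric_triangle (f t) (g t) (g u).
rewrite (metric_sym (g u) (g t)) in t2; rewrite (metric_sym (f u) (f t)) in t3.
rewrite ltr_norml; lra.
Unshelve. all: by end_near. Qed.

Lemma sup_dist_has_sup f g :
  has_sup (range (fun t : dseg rho => mdist (f t) (g t))).
Proof.
split.
  by exists (mdist (f (dseg0 rho)) (g (dseg0 rho))); exists (dseg0 rho).
have /(@subspace_valL_continuousP' _ (dseg rho) R 0) := @continuous_mdist f g.
move/(continuous_compact)/(_ (@segment_compact R _ _)).
move/compact_bounded => [M [_ /(_ (M + 1))]]; rewrite ltrDl => /(_ ltr01) hM.
exists (M + 1) => _ [t _ <-].
apply: (le_trans (ler_norm _)); apply: hM; exists (\val t).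
  by case: t => t /= /set_mem.
exact: (congr1 (@^~ t) (valLK 0 (fun t : dseg rho => mdist (f t) (g t)))).
Qed.

Lemma sup_dist_ub f g (t : dseg rho) : mdist (f t) (g t) <= sup_dist f g.
Proof. by apply: sup_upper_bound; [exact: sup_dist_has_sup|exists t]. Qed.

Lemma sup_dist_le f g (M : R) :
  (forall t, mdist (f t) (g t) <= M) -> sup_dist f g <= M.
Proof.
move=> fgM; apply: ge_sup; first by case: (sup_dist_has_sup f g).
by move=> _ [t _ <-].
Qed.

Let sup_distxx f : sup_dist f f = 0.
Proof.
apply/eqP; rewrite eq_le; apply/andP; split.
  by apply: sup_dist_le => t; rewrite mdistxx.
by rewrite -(mdistxx (f (dseg0 rho))) sup_dist_ub.
Qed.

Let sup_dist_positivity f g : sup_dist f g = 0 -> f = g.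
Proof.
move=> fg0; apply/continuousEP => t; apply: mdist_positivity.
by apply/eqP; rewrite eq_le mdist_ge0 andbT -fg0 sup_dist_ub.
Qed.

Let sup_dist_sym f g : sup_dist f g = sup_dist g f.
Proof. by congr sup; apply: eq_imagel => t _; exact: metric_sym. Qed.

Let sup_dist_triangle g f h : sup_dist f h <= sup_dist f g + sup_dist g h.
Proof.
apply: sup_dist_le => t; apply: (le_trans (metric_triangle _ (g t) _)).
by apply: lerD; exact: sup_dist_ub.
Qed.

HB.instance Definition _ := @isMetric.Build R (Cseg X rho) sup_dist
  sup_distxx sup_dist_positivity sup_dist_sym sup_dist_triangle.

End Cseg_metric.

HB.instance Definition _ (R : realType) (X : polishType R) (rho : delay R) :=
  isPointed.Build (Cseg X rho) (cst point : continuousType (dseg rho) X).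

(* The state space {1, ..., N.+1} of the chain, relabelled {0, ..., N}, with the
   metric |i - j|. *)
Definition regime (R : realType) (N : nat) := 'I_N.+1.

Section regime_metric.
Context {R : realType} {N : nat}.
Implicit Types i j k : regime R N.

HB.instance Definition _ := Finite.on (regime R N).
HB.instance Definition _ := isPointed.Build (regime R N) (@ord0 N).

Definition regime_dist i j : R := `|i%:R - j%:R|.

Let regime_distxx i : regime_dist i i = 0.
Proof. by rewrite /regime_dist subrr normr0. Qed.

Let regime_dist_positivity i j : regime_dist i j = 0 -> i = j.
Proof.
by move/normr0_eq0/eqP; rewrite subr_eq0 eqr_nat => /eqP ij; exact: val_inj.
Qed.

Let regime_dist_sym i j : regime_dist i j = regime_dist j i.
Proof. exact: distrC. Qed.

Let regime_dist_triangle j i k :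
  regime_dist i k <= regime_dist i j + regime_dist j k.
Proof. exact: ler_distD. Qed.

HB.instance Definition _ := @isMetric.Build R (regime R N) regime_dist
  regime_distxx regime_dist_positivity regime_dist_sym regime_dist_triangle.

End regime_metric.

HB.instance Definition _ (T U : ptopologicalType) := Pointed.on (T * U)%type.

Notation borel E := (g_sigma_algebraType (@open E%type)).

Section feller_processes.
Context {R : realType} {d : measure_display} {Omega : measurableType d}.
Variable P : probability Omega R.
Context {E : ptopologicalType}.
Implicit Type phi : E -> R.

Definition bounded_continuous phi :=
  continuous phi /\ [bounded phi x | x in setT].

(* sigma (Y v : s <= v <= u) *)
Definition history (Y : R -> Omega -> E) (s u : R) : set (set Omega) :=
  <<s \bigcup_(v in `[s, u])
        preimage_set_system setT (Y v : Omega -> borel E) measurable >>.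

(* [Y s x t] is the state at time [t] of the process started from [x] at time
   [s]. *)
Implicit Type Y : R -> E -> R -> Omega -> E.

Definition transition_op Y (s t : R) phi (x : E) : R :=
  \int[P]_w phi (Y s x t w).

Record feller_markov Y : Prop := {
  feller_markov_measurable : forall s x t, s <= t ->
    measurable_fun setT (Y s x t : Omega -> borel E) ;
  feller_markov_start : forall s x w, Y s x s w = x ;
  (* E[phi(Y_t) | sigma (Y_v : s <= v <= u)] = (P_{u,t} phi)(Y_u) a.s. *)
  feller_markov_markov : forall s u t x phi A, s <= u -> u <= t ->
    measurable_fun setT (phi : borel E -> R) -> [bounded phi y | y in setT] ->
    history (Y s x) s u A ->
    \int[P]_(w in A) phi (Y s x t w) =
    \int[P]_(w in A) transition_op Y u t phi (Y s x u w) ;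
  feller_markov_feller : forall s t phi, s <= t ->
    bounded_continuous phi -> bounded_continuous (transition_op Y s t phi) }.

Definition evolution_system Y (mu : R -> probability (borel E) R) :=
  forall s t phi, s < t -> bounded_continuous phi ->
    \int[mu s]_x transition_op Y s t phi x = \int[mu t]_x phi x.

Definition tight (m : nat -> probability (borel E) R) :=
  forall e : R, 0 < e ->
    exists2 K : set E, compact K & forall n, ((1 - e)%:E < m n K)%E.

Definition weak_cvg (m : nat -> probability (borel E) R)
    (mu : probability (borel E) R) :=
  forall phi, bounded_continuous phi ->
    \int[m n]_x phi x @[n --> \oo] --> \int[mu]_x phi x.

End feller_processes.

Section markov_chains.
Context {R : realType} {d : measure_display} {Omega : measurableType d}.
Variables (P : probability Omega R) (N : nat).
Local Notation S := (regime R N).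

Definition generator (Q : 'M[R]_N.+1) :=
  (forall i k, i != k -> 0 <= Q i k) /\ (forall i, \sum_k Q i k = 0).

Implicit Type r : R -> S -> R -> Omega -> S.

(* The chain is time homogeneous, its transition matrix over a duration [h]
   being the one observed from time 0. *)
Definition chain_transition r (h : R) : 'M[R]_N.+1 :=
  \matrix_(i, k) fine (P [set w | r 0 i h w = k]).

Record markov_chain (Q : 'M[R]_N.+1) r : Prop := {
  markov_chain_Q : generator Q ;
  markov_chain_measurable : forall s j t, s <= t ->
    measurable_fun setT (r s j t : Omega -> borel S) ;
  markov_chain_start : forall s j w, r s j s w = j ;
  markov_chain_right_continuous : forall s j t w, s <= t ->
    r s j u w @[u --> t^'+] --> r s j t w ;
  markov_chain_markov : forall s j u t i k A, s <= u -> u <= t ->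
    history (r s j) s u A ->
    P (A `&` [set w | r s j u w = i] `&` [set w | r s j t w = k]) =
    (P (A `&` [set w | r s j u w = i]) * (chain_transition r (t - u) i k)%:E)%E ;
  markov_chain_generator : forall i k,
    h^-1 * (chain_transition r h i k - (i == k)%:R) @[h --> 0^'+] --> Q i k ;
  markov_chain_irreducible : forall i k,
    exists2 h, 0 <= h & 0 < chain_transition r h i k }.

End markov_chains.

Section delay_processes.
Context {R : realType} {X : polishType R} {N : nat}.
Local Notation S := (regime R N).

(* T_rho : H_rho -> H_0 *)
Definition eval0 (rho : delay R) : borel (Cseg X rho * S) -> borel (X * S) :=
  fun x : Cseg X rho * S => (x.1 (dseg0 rho), x.2).

Lemma eval0_continuous (rho : delay R) :
  continuous (@eval0 rho : Cseg X rho * S -> X * S).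
Proof.
case=> f j U [[A B] /= [/nbhs_ballP[e /= e0 eA] jB] ABU].
exists (ball f e, B) => /=; first by split => //; exact: nbhsx_ballx.
move=> [g k] /= [+ Bk]; rewrite ballEmdist/= => fge; apply: ABU; split => //=.
by apply: eA; rewrite ballEmdist/=; exact: le_lt_trans (sup_dist_ub _ _ _) fge.
Qed.

Let eval0_measurable (rho : delay R) : measurable_fun setT (@eval0 rho).
Proof.
apply: (@measurability _ _ (borel (Cseg X rho * S)) (borel (X * S)) setT
  (@eval0 rho) (@open (X * S)%type) erefl) => _ [A oA <-].
rewrite setTI; apply: sub_sigma_algebra.
by apply: open_comp oA => x _; exact: eval0_continuous.
Qed.

HB.instance Definition _ (rho : delay R) :=
  isMeasurableFun.Build _ _ _ _ (@eval0 rho) (@eval0_measurable rho).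

(* mu \o T_rho^-1 *)
Definition eval0_law (rho : delay R)
    (mu : probability (borel (Cseg X rho * S)) R) :
    probability (borel (X * S)) R :=
  distribution mu (@eval0 rho).

(* The restriction map H_1 -> H_rho *)
Definition restrict_seg (rho : delay R) (x : Cseg X (delay1 R) * S) :
    Cseg X rho * S :=
  ((x.1 : continuousType _ _) \o @dseg_incl R rho : continuousType _ _, x.2).

Definition restrict_set (rho : delay R) (D : set (Cseg X (delay1 R))) :
    set (Cseg X rho * S) :=
  @restrict_seg rho @` (D `*` setT).

Definition with_regime {Omega E : Type} (Z : R -> E -> S -> R -> Omega -> E)
    (r : R -> S -> R -> Omega -> S) :
    R -> E * S -> R -> Omega -> E * S :=
  fun s x t w => (Z s x.1 x.2 t w, r s x.2 t w).

End delay_processes.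

Arguments restrict_set {R X N} rho D.

(* Main.v *)
(* Tightness: the evaluation at 0 maps each restriction of a compact set K1 to
   the same compact set, whatever the delay.

   Limit: for phi bounded and Lipschitz in X, uniformly in the regime, the
   convergence in probability makes P^rho (phi o T) - (P^0 phi) o T small
   uniformly on the restriction of K1, while it is bounded by 2 sup|phi| on the
   complement, whose mu_s^rho-measure is small.  Integrating against
   mu_s^{rho_n} and letting n go to infinity gives the evolution identity for
   phi.  A bounded continuous phi is the pointwise limit of its
   inf-convolutions inf_y (phi(y, j) + n d(x, y)), which have the same bound
   and are Lipschitz, so dominated convergence concludes. *)
Require Import Defs.
From mathcomp Require Import all_boot all_order all_algebra.
From mathcomp Require Import all_classical all_reals all_analysis.
From mathcomp Require Import measurable_realfun lra.

Set Implicit Arguments.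
Unset Strict Implicit.
Unset Printing Implicit Defensive.

Import Order.TTheory GRing.Theory Num.Theory.
Import numFieldNormedType.Exports.

Local Open Scope classical_set_scope.
Local Open Scope ring_scope.

(** * Integrals of bounded functions against a probability measure *)

Section bounded_integrals.
Context {R : realType} {d : measure_display} {T : measurableType d}.
Variable mu : probability T R.
Implicit Types (f : T -> R) (M a b : R).

Lemma bounded_integrable f M : measurable_fun setT f ->
  (forall x, `|f x| <= M) -> mu.-integrable setT (EFin \o f).
Proof.
move=> mf fM; apply: measurable_bounded_integrable => //.
  exact: le_lt_trans (probability_le1 mu measurableT) (ltry 1).
exists M; split; rewrite ?num_real// => y My x _ /=.
exact: le_trans (fM x) (ltW My).
Qed.

(** Pointwise |f| <= a + b 1_A, and a probability measure integrates the constant a to itself. This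
    form serves both for bad events in Omega and for small sets of initial data. *)
Lemma normr_Rintegral_le f (A : set T) a b : measurable_fun setT f ->
  measurable A -> 0 <= b -> (forall x, `|f x| <= a + b) ->
  (forall x, ~ A x -> `|f x| <= a) ->
  `|\int[mu]_x f x| <= a + b * fine (mu A).
Proof.
move=> mf mA b0 fab fa.
have fi := bounded_integrable mf fab.
have mnf : measurable_fun setT (fun x => `|f x|) by exact: measurableT_comp.
have nfi : mu.-integrable setT (EFin \o (fun x => `|f x|)).
  by apply: (bounded_integrable mnf (M := a + b)) => x; rewrite normr_id.
have ci : mu.-integrable setT (EFin \o cst a).
  by apply: (bounded_integrable (M := `|a|)).
have ii : mu.-integrable setT (EFin \o (\1_A : T -> R)).
  apply: (bounded_integrable (M := 1)) => // x.
  by rewrite indicE; case: (_ \in _); rewrite ?normr1 ?normr0 ?ler01.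
have bii : mu.-integrable setT (EFin \o (fun x => b * \1_A x)).
  apply: (bounded_integrable (M := b)); first exact: measurable_funM.
  by move=> x; rewrite indicE; case: (_ \in _);
    rewrite ?mulr1 ?mulr0 ?normr0// ger0_norm.
apply: (le_trans (le_normr_Rintegral _ fi)) => //.
have -> : a + b * fine (mu A) = \int[mu]_x (a + b * \1_A x).
  rewrite RintegralD// RintegralZl// Rintegral_cst//.
  rewrite [fine (mu setT)](_ : _ = 1); last first.
    exact: (congr1 fine (probability_setT mu)).
  rewrite mulr1; congr (_ + _ * _).
  by rewrite /Rintegral integral_indic// setIT.
apply: le_Rintegral => //.
  rewrite (_ : _ \o _ = (EFin \o cst a) \+ (EFin \o (fun x => b * \1_A x)%R))%E.
    exact: integrableD.
  by apply/funext => x.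
move=> x _; rewrite indicE; have [xA|xA] := boolP (x \in A).
  by rewrite mulr1.
by rewrite mulr0 addr0; apply: fa => /mem_set; apply/negP.
Qed.

Lemma normr_Rintegral_bound f M : measurable_fun setT f ->
  (forall x, `|f x| <= M) -> `|\int[mu]_x f x| <= M.
Proof.
move=> mf fM; have := @normr_Rintegral_le f set0 M 0 mf.
by rewrite mul0r addr0; apply.
Qed.

Lemma bounded_Rintegral_cvg (f_ : nat -> T -> R) f M :
  (forall n, measurable_fun setT (f_ n)) ->
  (forall n x, `|f_ n x| <= M) ->
  (forall x, f_ n x @[n --> \oo] --> f x) ->
  \int[mu]_x f_ n x @[n --> \oo] --> \int[mu]_x f x.
Proof.
move=> mf_ f_M f_f.
have mf : measurable_fun setT f by apply: (measurable_fun_cvg mf_) => x _.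
have [] := @dominated_convergence _ T R mu setT measurableT
  (fun n => EFin \o f_ n) (EFin \o f) (EFin \o cst M).
- by move=> n; exact/measurable_EFinP.
- exact/measurable_EFinP.
- by apply: aeW => x _; apply/cvg_EFin; [exact: nearW|exact: f_f].
- by apply: (bounded_integrable (M := `|M|)).
- by apply: aeW => x n _; rewrite lee_fin.
move=> fi _ cvf; apply: fine_cvg.
rewrite /Rintegral fineK; last exact: integrable_fin_num.
exact: cvf.
Qed.

End bounded_integrals.

(** * Bounded continuous functions and Borel measurability *)

Lemma bounded_continuousP {R : realType} {E : ptopologicalType} (phi : E -> R) :
  bounded_continuous phi <->
  continuous phi /\ exists2 M : R, 0 <= M & forall x, `|phi x| <= M.
Proof.
split=> -[cphi].
  move=> /pinfty_ex_gt0[M M0 bM]; split=> //.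
  by exists M; [exact: ltW|move=> x; exact: bM].
move=> [M M0 phiM]; split => //; exists M.
split; rewrite ?num_real// => y My x _ /=; exact: le_trans (phiM x) (ltW My).
Qed.

(** The target carries the sigma-algebra of R generated by open intervals, not [borel R], so the
    general statement that follows does not apply directly. *)
Lemma continuous_measurable_funR {R : realType} {E : ptopologicalType}
  (phi : E -> R) : continuous phi -> measurable_fun setT (phi : borel E -> R).
Proof.
move=> /continuousP cphi; apply: (measurability _ (RGenOpens.measurableE R)).
move=> _ [_ [a [b ->] <-]]; rewrite setTI.
by apply: sub_sigma_algebra; apply: cphi; exact: interval_open.
Qed.

Lemma continuous_measurable_fun_borel {E F : ptopologicalType} (g : E -> F) :
  continuous g -> measurable_fun setT (g : borel E -> borel F).
Proof.
move=> /continuousP cg.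
apply: (@measurability _ _ (borel E) (borel F) setT g (@open F) erefl).
by move=> _ [A oA <-]; rewrite setTI; apply: sub_sigma_algebra; exact: cg.
Qed.

(** * The distance function and events defined by it *)

Section mdist_continuity.
Context {R : realType} {X : metricType R}.

Lemma mdistrC_le (x y z : X) : `|mdist x z - mdist y z| <= mdist x y.
Proof.
have := metric_triangle x y z; have := metric_triangle y x z.
rewrite (metric_sym y x) ler_norml; lra.
Qed.

Lemma mdistl_continuous (z : X) : continuous (fun x : X => mdist x z).
Proof.
move=> x; apply/(@cvgrPdist_lt _ R^o _ _ (nbhs_filter x)) => e e0.
apply/nbhs_ballP; exists e => //= y; rewrite ballEmdist/=.
exact: le_lt_trans (mdistrC_le _ _ _).
Qed.

End mdist_continuity.

(** By separability, d(U, V) < eta exactly when d(U, q) + d(V, q) < eta for some q in a countable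
    dense set, and each distance to a fixed q is measurable. Joint measurability of the pair (U, V)
    is thus never invoked. *)
Lemma measurable_mdist_ge {R : realType} {d : measure_display}
    {Omega : measurableType d} {X : polishType R} (U V : Omega -> borel X)
    (eta : R) :
  measurable_fun setT U -> measurable_fun setT V ->
  measurable [set w | eta <= mdist (U w : X) (V w)].
Proof.
move=> mU mV.
have [D cD dD] : exists2 D : set X, countable D & dense D.
  exact: separable_subproof.
have mdq (q : X) (W : Omega -> borel X) : measurable_fun setT W ->
    measurable_fun setT (fun w => mdist (W w : X) q).
  move=> mW.
  apply: (@measurableT_comp _ _ _ _ _ _ (fun x : borel X => mdist (x : X) q))
    => //.
  exact: (@continuous_measurable_funR R X _ (@mdistl_continuous R X q)).
rewrite (_ : [set w | _] =
    ~` \bigcup_(q in D) [set w | mdist (U w : X) q + mdist (V w : X) q < eta]).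
  apply: measurableC; have [->|[f]] := pfcard_geP cD.
    by rewrite bigcup_set0.
  rewrite (reindex_bigcup f setT); [|exact: funS|exact: surj].
  apply: bigcup_measurable => n _.
  have := measurable_funD (mdq (f n) _ mU) (mdq (f n) _ mV).
  move=> /(_ measurableT _ (measurable_itv `]-oo, eta[)); rewrite setTI.
  by congr measurable; apply/seteqP; split => w /=; rewrite in_itv.
apply/seteqP; split => [w /= etaUV [q _ /=]|w /= nUV].
  have := metric_triangle (U w : X) q (V w); rewrite (metric_sym q).
  by move: etaUV => /[swap] /[swap]; lra.
rewrite leNgt; apply/negP => UV.
(* Half the gap: a point q within e of U is within d(U, V) + e of V, so the two distances add up to
   less than eta. *)
pose e := (eta - mdist (U w : X) (V w)) / 2.
have e0 : 0 < e by rewrite divr_gt0// subr_gt0.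
have [q [bq Dq]] : (ball (U w : X) e)° `&` D !=set0.
  apply: dD; last exact: open_interior.
  by exists (U w); exact: nbhsx_ballx.
apply: nUV; exists q => //=; have := interior_subset bq; rewrite ballEmdist/=.
have := metric_triangle (V w : X) (U w) q.
rewrite (metric_sym (V w : X) (U w)) /e.
lra.
Qed.

(** * Lipschitz regularization by inf-convolution *)

Section inf_convolution.
Context {R : realType} {X : metricType R} {N : nat}.
Local Notation S := (regime R N).
Variables (phi : X * S -> R) (M : R).
Hypothesis phiM : forall x, `|phi x| <= M.

(** Distinct integers differ by at least 1, so the unit ball around j is {j} and the topology is
    discrete. *)
Lemma regime_nbhs1 (j : S) : nbhs j [set j].
Proof.
apply/nbhs_ballP; exists 1 => //= i; rewrite ballEmdist /mdist/= /regime_dist.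
have [->//|ij] := eqVneq i j.
have : (1 : R) <= `|(j : nat)%:Z%:~R - (i : nat)%:Z%:~R|.
  rewrite -intrB -intr_norm -[1]/(1%:~R) ler_int -gtz0_ge1 normr_gt0 subr_eq0.
  by rewrite eqz_nat eq_sym.
by rewrite !pmulrn ltNge => ->.
Qed.

(* Regularization in the first variable only: the two processes compared below
   share the same regime. *)
Definition inf_convolution (k : R) (x : X * S) : R :=
  inf (range (fun y : X => phi (y, x.2) + k * mdist x.1 y)).

Section fixed_slope.
Variable k : R.
Hypothesis k0 : 0 <= k.

Lemma inf_convolution_lbound x :
  lbound (range (fun y : X => phi (y, x.2) + k * mdist x.1 y)) (- M).
Proof.
move=> _ [y _ <-]; have := phiM (y, x.2); rewrite ler_norml => /andP[+ _].
by move=> /le_trans; apply; rewrite lerDl mulr_ge0// mdist_ge0.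
Qed.

Lemma inf_convolution_le x y :
  inf_convolution k x <= phi (y, x.2) + k * mdist x.1 y.
Proof.
by apply: ge_inf; [exists (- M); exact: inf_convolution_lbound|exists y].
Qed.

Lemma inf_convolution_ge x a :
  (forall y, a <= phi (y, x.2) + k * mdist x.1 y) -> a <= inf_convolution k x.
Proof.
move=> ha; apply: lb_le_inf; first by eexists; exists x.1.
by move=> _ [y _ <-].
Qed.

Lemma inf_convolution_le_id x : inf_convolution k x <= phi x.
Proof.
have := inf_convolution_le x x.1; rewrite mdistxx mulr0 addr0.
by case: x.
Qed.

Lemma inf_convolution_bound x : `|inf_convolution k x| <= M.
Proof.
rewrite ler_norml; apply/andP; split.
  apply: inf_convolution_ge => y; apply: (@inf_convolution_lbound x).
  by exists y.
apply: (le_trans (inf_convolution_le_id x)); apply: le_trans (phiM x).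
exact: ler_norm.
Qed.

(** Each competitor in the infimum is k-Lipschitz in x by the triangle inequality, and the
    competitors for x and y are indexed by the same z because j is shared. *)
Lemma inf_convolution_lipschitz x y j :
  `|inf_convolution k (x, j) - inf_convolution k (y, j)| <= k * mdist x y.
Proof.
wlog suff h : x y / inf_convolution k (x, j) - inf_convolution k (y, j) <=
    k * mdist x y.
  rewrite ler_norml h andbT lerNl opprB (metric_sym x); exact: h.
rewrite lerBlDr -lerBlDl; apply: inf_convolution_ge => z /=.
have /= := inf_convolution_le (x, j) z.
have := ler_wpM2l k0 (metric_triangle x y z); rewrite mulrDr; lra.
Qed.

Lemma inf_convolution_continuous : continuous (inf_convolution k).
Proof.
move=> [x j]; apply/(@cvgrPdist_le _ R^o _ _ (nbhs_filter (x, j))) => e e0.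
(* Dividing by k + 1 rather than k covers the case k = 0. *)
have k1 : 0 < k + 1 by exact: ltr_wpDl.
(* The regime is frozen, as the Lipschitz bound only compares points with the same j. *)
exists (ball x (e / (k + 1)), [set j]) => /=.
  by split; [apply: nbhsx_ballx; exact: divr_gt0|exact: regime_nbhs1].
move=> [y i] /= [+ ->]; rewrite ballEmdist/= ltr_pdivlMr// => xy.
apply: (le_trans (inf_convolution_lipschitz _ _ _)); apply: ltW.
by apply: le_lt_trans xy; rewrite mulrDr mulr1 mulrC lerDl mdist_ge0.
Qed.

End fixed_slope.

(** Competitors y near x satisfy phi (y, j) >= phi (x, j) - e by continuity. For those at distance
    at least dl, the penalty n * dl eventually reaches 2 M, which bounds the variation of phi. *)
Lemma inf_convolution_cvg x : continuous phi ->
  inf_convolution n%:R x @[n --> \oo] --> phi x.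
Proof.
case: x => x j /(_ (x, j)) cphi; apply/(@cvgrPdist_le _ R^o) => e e0.
have M0 : 0 <= M by exact: le_trans (phiM (x, j)).
move/(@cvgrPdist_le _ R^o _ _ (nbhs_filter (x, j)))/(_ e e0) : cphi.
move=> [[A B] /= [/nbhs_ballP[dl /= dl0 dlA] /nbhs_singleton Bj] AB].
have : \forall n \near \oo, 2 * M / dl <= n%:R by exact: nbhs_infty_ger.
apply: filterS => n; rewrite ler_pdivrMr// => nM.
have n0 : 0 <= n%:R :> R by [].
rewrite ger0_norm; last by rewrite subr_ge0 inf_convolution_le_id.
rewrite lerBlDr -lerBlDl; apply: inf_convolution_ge => y /=.
have [xy|xy] := ltP (mdist x y) dl.
  have : `|phi (x, j) - phi (y, j)| <= e.
    by apply: (AB (y, j)) => /=; split => //; apply: dlA; rewrite ballEmdist.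
  have := mulr_ge0 n0 (mdist_ge0 x y); rewrite ler_norml => ? /andP[]; lra.
have := ler_wpM2l n0 xy.
have := phiM (x, j); have := phiM (y, j); rewrite !ler_norml; lra.
Qed.

End inf_convolution.

(** * Compact sets of segments and tightness of the laws at the endpoint 0 *)

Section process_compactness.
Context {R : realType} {X : polishType R} {N : nat}.
Local Notation S := (regime R N).

(** Used to see that compact subsets of the product state spaces are closed, hence Borel. *)
Lemma prod_hausdorff (T U : topologicalType) :
  hausdorff_space T -> hausdorff_space U -> hausdorff_space (T * U)%type.
Proof.
move=> hT hU [x y] [x' y'] xy.
congr pair; [apply: hT => A B nA nB|apply: hU => A B nA nB].
  have [] := xy (A `*` setT) (B `*` setT).
  - by exists (A, setT) => //=; split => //; exact: filterT.
  - by exists (B, setT) => //=; split => //; exact: filterT.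
  - by move=> [p q] /= [[Ap _] [Bp _]]; exists p.
have [] := xy (setT `*` A) (setT `*` B).
- by exists (setT, A) => //=; split => //; exact: filterT.
- by exists (setT, B) => //=; split => //; exact: filterT.
- by move=> [p q] /= [[_ Aq] [_ Bq]]; exists q.
Qed.

(** Restriction is 1-Lipschitz for the supremum metrics, the supremum being taken over fewer
    points. *)
Lemma restrict_seg_continuous (rho : delay R) :
  continuous (@restrict_seg R X N rho).
Proof.
case=> f j U [[A B] /= [/nbhs_ballP[e /= e0 eA] jB] ABU].
exists (ball f (e / 2), B) => /=.
  by split => //; apply: nbhsx_ballx; rewrite divr_gt0.
move=> [g k] /= [+ Bk]; rewrite ballEmdist/= => fge; apply: ABU; split => //=.
apply: eA; rewrite ballEmdist/=; apply: (@le_lt_trans _ _ (e / 2)).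
  apply: sup_dist_le => t; apply: le_trans (ltW fge).
  exact: (sup_dist_ub f g (dseg_incl t)).
by rewrite ltr_pdivrMr// ltr_pMr// ltr1n.
Qed.

Lemma compact_with_regime (rho : delay R) (K : set (Cseg X rho)) :
  compact K -> compact (K `*` [set: S]).
Proof.
move=> cK; apply: compact_setX => //.
by apply: finite_compact; exact: finite_finset.
Qed.

Lemma restrict_set_compact (rho : delay R) (K : set (Cseg X (delay1 R))) :
  compact K -> compact (restrict_set rho K : set (Cseg X rho * S)).
Proof.
move=> cK; apply: continuous_compact; last exact: compact_with_regime.
exact/continuous_subspaceT/restrict_seg_continuous.
Qed.

Lemma restrict_set_measurable (rho : delay R) (K : set (Cseg X (delay1 R))) :
  compact K ->
  measurable (restrict_set rho K : set (borel (Cseg X rho * S))).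
Proof.
move=> cK.
have cl : closed (restrict_set rho K : set (Cseg X rho * S)).
  apply: compact_closed; last exact: restrict_set_compact.
  by apply: prod_hausdorff; exact: metric_hausdorff.
rewrite -(setCK (restrict_set rho K)); apply: measurableC.
by apply: sub_sigma_algebra; exact: closed_openC.
Qed.

(** The point 0 lies in every segment, so restriction keeps the value there. This removes the delay
    from the compact set used for tightness. *)
Lemma eval0_restrict_seg (rho : delay R) (x : Cseg X (delay1 R) * S) :
  eval0 (restrict_seg rho x) = eval0 x.
Proof.
(* The two copies of 0 differ only in their membership proofs. *)
rewrite /eval0 /restrict_seg/=; congr (x.1 _, _); exact: val_inj.
Qed.

Lemma eval0_law_tight (rho : nat -> delay R)
    (mu : forall n, probability (borel (Cseg X (rho n) * S)) R) :
  (forall eps : R, 0 < eps ->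
    exists2 K1 : set (Cseg X (delay1 R)), compact K1 &
      forall n, ((1 - eps)%:E < mu n (restrict_set (rho n) K1))%E) ->
  tight (fun n => eval0_law (mu n)).
Proof.
move=> tmu e e0; have [K cK muK] := tmu e e0.
have cC : compact (@eval0 _ X N _ @` (K `*` [set: S])).
  apply: continuous_compact; last exact: compact_with_regime.
  exact/continuous_subspaceT/eval0_continuous.
(* The evaluation is taken on the full segment [-1, 0], so the set is the same for all n. *)
exists (@eval0 _ X N _ @` (K `*` [set: S])) => // n.
apply: (lt_le_trans (muK n)); apply: le_measure; rewrite ?inE.
- exact: restrict_set_measurable.
- rewrite -[X in measurable X]setTI; apply: measurable_funP => //.
  rewrite -(setCK (_ @` _)); apply: measurableC.
  apply: sub_sigma_algebra; apply: closed_openC; apply: compact_closed => //.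
  by apply: prod_hausdorff; exact: metric_hausdorff.
- move=> _ [x Kx <-]; exists x => //; exact/esym/eval0_restrict_seg.
Qed.

End process_compactness.

(** * Change of variables and transition operators on bounded continuous functions *)

Lemma Rintegral_eval0_law {R : realType} {X : polishType R} {N : nat}
    (rho : delay R) (mu : probability (borel (Cseg X rho * regime R N)) R)
    (phi : X * regime R N -> R) M :
  measurable_fun setT (phi : borel (X * regime R N) -> R) ->
  (forall x, `|phi x| <= M) ->
  \int[eval0_law mu]_x phi x = \int[mu]_x phi (eval0 x).
Proof.
move=> mphi phiM.
have mphiT : measurable_fun setT
    (fun x : borel (Cseg X rho * regime R N) => phi (eval0 x)).
  by apply: measurableT_comp => //; exact: measurable_funP.
rewrite /Rintegral /eval0_law integral_distribution//.
  exact/measurable_EFinP.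
exact: (@bounded_integrable _ _ _ mu _ M).
Qed.

Section transition_op_bounds.
Context {R : realType} {d : measure_display} {Omega : measurableType d}.
Variable P : probability Omega R.
Context {E : ptopologicalType}.
Variable Y : R -> E -> R -> Omega -> E.
Hypothesis fmY : feller_markov P Y.

Lemma measurable_transition (s t : R) (phi : E -> R) (x : E) : s <= t ->
  continuous phi -> measurable_fun setT (fun w => phi (Y s x t w)).
Proof.
move=> st cphi; apply: (@measurableT_comp _ _ _ _ _ _ (phi : borel E -> R)).
  exact: continuous_measurable_funR.
exact: feller_markov_measurable fmY _ _ _ st.
Qed.

Lemma normr_transition_op_le (s t : R) (phi : E -> R) M (x : E) : s <= t ->
  continuous phi -> (forall y, `|phi y| <= M) ->
  `|transition_op P Y s t phi x| <= M.
Proof.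
move=> st cphi phiM; apply: normr_Rintegral_bound => //.
exact: measurable_transition.
Qed.

Lemma transition_op_continuous (s t : R) (phi : E -> R) M : s <= t -> 0 <= M ->
  continuous phi -> (forall y, `|phi y| <= M) ->
  continuous (transition_op P Y s t phi).
Proof.
move=> st M0 cphi phiM.
have bphi : bounded_continuous phi.
  by apply/bounded_continuousP; split => //; exists M.
by have [] := feller_markov_feller fmY st bphi.
Qed.

End transition_op_bounds.

(** * Passage to the limit of vanishing delay *)

Section delay_limit.
Context {R : realType} {d : measure_display} {Omega : measurableType d}.
Context {X : polishType R} {N : nat}.
Local Notation S := (regime R N).
Variable P : probability Omega R.
Variable r : R -> S -> R -> Omega -> S.
Variable Z0 : R -> X -> S -> R -> Omega -> X.
Hypothesis fm0 : feller_markov P (with_regime Z0 r).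

(** The event of the assumed convergence in probability: both processes live on the same Omega, and
    the delay-free one starts from the value at 0 of the initial segment. *)
Definition deviation (rho : delay R)
    (Z : R -> Cseg X rho -> S -> R -> Omega -> Cseg X rho)
    (s t eta : R) (x : Cseg X rho * S) : set Omega :=
  [set w | eta <= mdist (Z s x.1 x.2 t w (dseg0 rho))
                        (Z0 s (x.1 (dseg0 rho)) x.2 t w)].

Section one_delay.
Variables (rho : delay R).
Variable Z : R -> Cseg X rho -> S -> R -> Omega -> Cseg X rho.
Hypothesis fmZ : feller_markov P (with_regime Z r).

Lemma measurable_deviation (s t eta : R) (x : Cseg X rho * S) : s <= t ->
  measurable (deviation Z s t eta x).
Proof.
move=> st.
have mfst : measurable_fun setT (fst : borel (X * S) -> borel X).
  by apply: continuous_measurable_fun_borel => y; exact: cvg_fst.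
have mU : measurable_fun setT
    ((@eval0 R X N rho) \o (with_regime Z r s x t : Omega -> borel _)).
  apply: measurableT_comp; first exact: measurable_funP.
  exact: feller_markov_measurable fmZ _ _ _ st.
have mV : measurable_fun setT
    (with_regime Z0 r s (eval0 x) t : Omega -> borel (X * S)).
  exact: feller_markov_measurable fm0 _ _ _ st.
apply: (@measurable_mdist_ge _ _ _ _ _ _ eta).
  exact: (measurableT_comp mfst mU).
exact: (measurableT_comp mfst mV).
Qed.

(** Both processes carry the same regime [r s x.2 t w], so off the deviation event the modulus of
    phi bounds the difference by e; on that event it is at most 2 M. *)
Lemma transition_op_dist (phi : X * S -> R) (M e eta s t : R)
    (x : Cseg X rho * S) :
  s <= t -> continuous phi -> 0 <= M -> (forall y, `|phi y| <= M) -> 0 <= e ->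
  (forall y z j, mdist y z < eta -> `|phi (y, j) - phi (z, j)| <= e) ->
  `|transition_op P (with_regime Z r) s t (phi \o @eval0 R X N rho) x -
    transition_op P (with_regime Z0 r) s t phi (eval0 x)| <=
  e + 2 * M * fine (P (deviation Z s t eta x)).
Proof.
move=> st cphi M0 phiM e0 phie.
have cphiT : continuous (phi \o @eval0 R X N rho).
  by move=> y; apply: continuous_comp; [exact: eval0_continuous|exact: cphi].
have m1 := measurable_transition fmZ x st cphiT.
have m2 := measurable_transition fm0 (eval0 x) st cphi.
rewrite /transition_op -RintegralB//; last 2 first.
- by apply: (bounded_integrable P m1 (M := M)) => w; exact: phiM.
- by apply: (bounded_integrable P m2 (M := M)) => w; exact: phiM.
apply: normr_Rintegral_le.
- exact: measurable_funB.
- exact: measurable_deviation.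
- by rewrite mulr_ge0.
- move=> w; apply: (le_trans (ler_normB _ _)).
  rewrite -[leLHS]add0r; apply: lerD => //.
  by rewrite mulrC mulr_natr mulr2n; apply: lerD; exact: phiM.
- by move=> w /negP; rewrite -ltNge; exact: phie.
Qed.

End one_delay.

Variable Z : forall rho : delay R,
  R -> Cseg X rho -> S -> R -> Omega -> Cseg X rho.
Arguments Z : clear implicits.
Hypothesis fmZ : forall rho : delay R, feller_markov P (with_regime (Z rho) r).
Hypothesis Z_cvg : forall (K : set (Cseg X (delay1 R))) (s t eta : R),
  compact K -> K !=set0 -> s <= t -> 0 < eta ->
  ereal_sup [set P (deviation (Z rh) s t eta x) | x in restrict_set rh K]
    @[rh --> delay_to0 R] --> 0%E.
Variable rho : nat -> delay R.
Hypothesis rho0 : delay_val (rho n) @[n --> \oo] --> (0 : R).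

(** The limit along [delay_to0] yields a threshold a such that every delay below a has its supremum
    under dl; [rho n] is eventually below a. *)
Lemma deviation_near (K : set (Cseg X (delay1 R))) (s t eta dl : R) :
  compact K -> K !=set0 -> s <= t -> 0 < eta -> 0 < dl ->
  \forall n \near \oo, forall x, restrict_set (rho n) K x ->
    fine (P (deviation (Z (rho n)) s t eta x)) <= dl.
Proof.
move=> cK K0 st eta0 dl0.
have /= := Z_cvg cK K0 st eta0.
have nb : nbhs (0 : \bar R)%E [set y | (y < dl%:E)%E].
  apply: open_nbhs_nbhs; split; first exact: open_ereal_lt_ereal.
  by rewrite /= lte_fin.
move=> /(_ _ nb)[a /= a0 aP].
have : \forall n \near \oo, delay_val (rho n) < a.
  by apply: (cvgr_lt _ rho0).
apply: filterS => n /aP /= /ltW supdl x Kx.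
rewrite -lee_fin fineK; last first.
  exact: fin_num_measure _ (measurable_deviation (fmZ _) _ _ _).
by apply: le_trans supdl; apply: ereal_sup_ubound; exists x.
Qed.

Variable mu : forall n : nat, R -> probability (borel (Cseg X (rho n) * S)) R.
Arguments mu : clear implicits.
Hypothesis ev : forall n, evolution_system P (with_regime (Z (rho n)) r) (mu n).
Hypothesis tmu : forall t eps : R, 0 < eps ->
  exists2 K1 : set (Cseg X (delay1 R)), compact K1 &
    forall n, ((1 - eps)%:E < mu n t (restrict_set (rho n) K1))%E.
Variable nu : R -> probability (borel (X * S)) R.
Hypothesis mu_nu : forall t, weak_cvg (fun n => eval0_law (mu n t)) (nu t).

(** The positions reached at time t are not confined to a known compact set, hence the modulus of
    continuity uniform in position and regime. *)
Lemma limit_evolution_equicontinuous (phi : X * S -> R) (M s t : R) :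
  s < t -> continuous phi -> 0 <= M -> (forall y, `|phi y| <= M) ->
  (forall e : R, 0 < e -> exists2 eta : R, 0 < eta &
    forall y z j, mdist y z < eta -> `|phi (y, j) - phi (z, j)| <= e) ->
  \int[nu s]_x transition_op P (with_regime Z0 r) s t phi x =
  \int[nu t]_x phi x.
Proof.
move=> st cphi M0 phiM phieq; have les := ltW st.
pose psi := transition_op P (with_regime Z0 r) s t phi.
have cpsi : continuous psi := transition_op_continuous fm0 les M0 cphi phiM.
have psiM x : `|psi x| <= M := normr_transition_op_le fm0 x les cphi phiM.
have bphi : bounded_continuous phi.
  by apply/bounded_continuousP; split => //; exists M.
have bpsi : bounded_continuous psi.
  by apply/bounded_continuousP; split => //; exists M.
have cvpsi := mu_nu bpsi (t := s).
have cvphi := mu_nu bphi (t := t).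
have cvd := cvgB cvphi cvpsi.
(* By uniqueness of limits, it suffices that the difference of the integrals for [mu n] vanishes in
   the limit. *)
apply/esym/eqP; rewrite -subr_eq0; apply/eqP.
suff cv0 : (\int[eval0_law (mu n t)]_x phi x - \int[eval0_law (mu n s)]_x psi x)
    @[n --> \oo] --> (0 : R).
  exact: (cvg_unique (@Rhausdorff R) (cvd _) cv0).
apply/(@cvgrPdist_le _ R^o) => e e0.
have e30 : 0 < e / 3 by rewrite divr_gt0.
have [eta eta0 phie] := phieq _ e30.
(* q bounds both the deviation probability and the mass lost outside the compact set, each costing 2
   M q <= e / 3. The summand 1 covers M = 0, and q <= 1 keeps 1 - q nonnegative. *)
pose q := Num.min 1 (e / 3 / (2 * M + 1)).
have M1 : 0 < 2 * M + 1 by lra.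
have q0 : 0 < q by rewrite lt_min ltr01 divr_gt0.
have q1 : q <= 1 by rewrite ge_min lexx.
have Mq : 2 * M * q <= e / 3.
  have : q * (2 * M + 1) <= e / 3.
    by rewrite -ler_pdivlMr// ge_min lexx orbT.
  lra.
have [K cK muK] := tmu s q0.
(* The convergence hypothesis concerns nonempty K, as [ereal_sup] of the empty set is -oo. An empty
   K would have mass 0 > 1 - q, contradicting q <= 1. *)
have K0 : K !=set0.
  apply/set0P/negP => /eqP K0; have := muK 0%N.
  by rewrite /restrict_set K0 set0X image_set0 measure0 lte_fin; lra.
have := deviation_near cK K0 les eta0 q0; apply: filterS => n devn.
rewrite sub0r normrN.
have cphiT : continuous (phi \o @eval0 R X N (rho n)).
  by move=> y; apply: continuous_comp; [exact: eval0_continuous|exact: cphi].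
have phiTM x : `|(phi \o @eval0 R X N (rho n)) x| <= M by exact: phiM.
have bphiT : bounded_continuous (phi \o @eval0 R X N (rho n)).
  by apply/bounded_continuousP; split => //; exists M.
rewrite (Rintegral_eval0_law _ _ phiM); last exact: continuous_measurable_funR.
rewrite (Rintegral_eval0_law _ _ psiM); last exact: continuous_measurable_funR.
(* The evolution property brings the integral at time t back to time s, so that both integrands are
   compared under [mu n s]. *)
rewrite -(ev st bphiT).
have m1 : measurable_fun setT (transition_op P (with_regime (Z (rho n)) r) s t
    (phi \o @eval0 R X N (rho n)) : borel _ -> R).
  apply: continuous_measurable_funR.
  exact: (transition_op_continuous (fmZ _) les M0 cphiT phiTM).
have b1 x := normr_transition_op_le (fmZ (rho n)) x les cphiT phiTM.
have m2 : measurable_fun setT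
    ((psi \o @eval0 R X N (rho n)) : borel _ -> R).
  apply: continuous_measurable_funR => y.
  by apply: continuous_comp; [exact: eval0_continuous|exact: cpsi].
have b2 x : `|(psi \o @eval0 R X N (rho n)) x| <= M by exact: psiM.
rewrite -RintegralB//; last 2 first.
- exact: bounded_integrable m1 b1.
- exact: bounded_integrable m2 b2.
have mK := @restrict_set_measurable R X N (rho n) K cK.
(* The three terms come from the modulus of phi, the deviation probability over the restriction of
   K, and the mass of its complement. *)
apply: (@le_trans _ _ (e / 3 + 2 * M * q +
    2 * M * fine (mu n s (~` restrict_set (rho n) K)))).
  apply: normr_Rintegral_le.
  - exact: measurable_funB.
  - exact: measurableC.
  - by rewrite mulr_ge0.
  - move=> x; apply: (le_trans (ler_normB _ _)).
    apply: (le_trans (lerD (b1 x) (b2 x))).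
    have := mulr_ge0 M0 (ltW q0); lra.
  move=> x /contrapT Kx.
  have := transition_op_dist (fmZ _) x les cphi M0 phiM (ltW e30) phie.
  move=> /le_trans; apply.
  by rewrite lerD2l ler_wpM2l ?mulr_ge0//; exact: devn.
have : fine (mu n s (~` restrict_set (rho n) K)) <= q.
  have muKfin := fin_num_measure (mu n s) _ mK.
  have := muK n; rewrite -[X in (_ < X)%E](fineK muKfin) lte_fin.
  by rewrite probability_setC// fineB//=; lra.
move=> /(ler_wpM2l (mulr_ge0 (ler0n R 2) M0)); lra.
Qed.

Lemma limit_evolution_system : evolution_system P (with_regime Z0 r) nu.
Proof.
move=> s t phi st /bounded_continuousP[cphi [M M0 phiM]].
have les := ltW st.
pose phi_ n := inf_convolution phi n%:R.
have n0 n : 0 <= n%:R :> R by [].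
have phi_M n x : `|phi_ n x| <= M by exact: inf_convolution_bound.
have phi_c n : continuous (phi_ n) by exact: (inf_convolution_continuous phiM).
have phi_cvg x : phi_ n x @[n --> \oo] --> phi x.
  exact: (@inf_convolution_cvg _ _ _ phi M phiM x cphi).
have cv1 : \int[nu t]_x phi_ n x @[n --> \oo] --> \int[nu t]_x phi x.
  apply: (@bounded_Rintegral_cvg _ _ _ (nu t) phi_ phi M) => // n.
  exact: continuous_measurable_funR.
have cv2 : \int[nu s]_x transition_op P (with_regime Z0 r) s t (phi_ n) x
    @[n --> \oo] --> \int[nu s]_x transition_op P (with_regime Z0 r) s t phi x.
  apply: (@bounded_Rintegral_cvg _ _ _ (nu s) _ _ M).
  - move=> n; apply: continuous_measurable_funR.
    exact: (transition_op_continuous fm0 les M0 (phi_c n) (phi_M n)).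
  - move=> n x.
    exact: (normr_transition_op_le fm0 x les (phi_c n) (phi_M n)).
  (* Dominated convergence under P gives pointwise convergence of the transition operators, as
     needed for dominated convergence under [nu s]. *)
  move=> x; apply: (@bounded_Rintegral_cvg _ _ _ P _ _ M) => //.
  by move=> n; exact: (measurable_transition fm0).
(* Both sides of the identity converge, so it remains to equate them for each inf-convolution. *)
apply: (cvg_unique (@Rhausdorff R) cv2).
apply: cvg_trans cv1; apply: near_eq_cvg; apply: nearW => n.
apply/esym; apply: (@limit_evolution_equicontinuous _ M) => // e e0.
(* The n-Lipschitz bound supplies the modulus; n + 1 avoids dividing by zero at n = 0. *)
exists (e / (n%:R + 1)) => [|y z j yz]; first by rewrite divr_gt0// ltr_wpDl.
apply: (le_trans (inf_convolution_lipschitz phiM _ _ _ _)) => //.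
apply: ltW; move: yz; rewrite ltr_pdivlMr ?ltr_wpDl//; apply: le_lt_trans.
by rewrite mulrDr mulr1 mulrC lerDl mdist_ge0.
Qed.

End delay_limit.

(** * Tightness and the limiting evolution system combined *)

Theorem theorem3p1 (R : realType) (d : measure_display)
    (Omega : measurableType d) (P : probability Omega R)
    (N : nat) (Q : 'M[R]_N.+1)
    (r : R -> regime R N -> R -> Omega -> regime R N)
    (X : polishType R)
    (Z : forall rho : delay R,
      R -> Cseg X rho -> regime R N -> R -> Omega -> Cseg X rho)
    (Z0 : R -> X -> regime R N -> R -> Omega -> X)
    (rho : nat -> delay R)
    (mu : forall n : nat,
      R -> probability (borel (Cseg X (rho n) * regime R N)) R) :
  markov_chain P Q r ->
  (forall rh : delay R, feller_markov P (with_regime (Z rh) r)) ->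
  feller_markov P (with_regime Z0 r) ->
  (forall (K : set (Cseg X (delay1 R))) (s t eta : R),
    compact K -> K !=set0 -> s <= t -> 0 < eta ->
    ereal_sup [set P [set w | eta <= mdist
                (Z rh s x.1 x.2 t w (dseg0 rh)) (Z0 s (x.1 (dseg0 rh)) x.2 t w)]
              | x in restrict_set rh K] @[rh --> delay_to0 R] --> 0%E) ->
  (forall n : nat, evolution_system P (with_regime (Z (rho n)) r) (mu n)) ->
  (forall t eps : R, 0 < eps ->
    exists2 K1 : set (Cseg X (delay1 R)), compact K1 &
      forall n : nat, ((1 - eps)%:E < mu n t (restrict_set (rho n) K1))%E) ->
  (forall t : R, tight (fun n : nat => eval0_law (mu n t))) /\
  (delay_val (rho n) @[n --> \oo] --> (0 : R) ->
    forall nu : R -> probability (borel (X * regime R N)) R,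
      (forall t : R, weak_cvg (fun n : nat => eval0_law (mu n t)) (nu t)) ->
      evolution_system P (with_regime Z0 r) nu).
Proof.
move=> _ fmZ fm0 Z_cvg ev tmu; split => [t|rho0 nu mu_nu].
  exact/eval0_law_tight/tmu.
exact: (limit_evolution_system fm0 fmZ Z_cvg rho0 ev tmu mu_nu).
Qed.
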